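(* Let $(\mathcal{B}^{(n)})_{n\ge 1}$ be a family of von Neumann algebras together with homomorphisms $j_\pi:\mathcal{B}^{(m)}\to\mathcal{B}^{(n)}$, one for each $n\ge m\ge 1$ and each $\pi\in G_{nm}$, where $G_{nm}$ is the set of injective functions $\{0,\ldots,m-1\}\to\{0,\ldots,n-1\}$. For $n\ge 2$ and distinct $i,k\in\{0,\ldots,n-1\}$ put $\mathcal{B}^{(n)}_{ik}=j_\pi(\mathcal{B}^{(2)})\subset\mathcal{B}^{(n)}$, where $\pi\in G_{n2}$ is given by $\pi(0)=i$, $\pi(1)=k$. Assume: (1) for every $n\ge 2$ and every $j\in\{0,\ldots,n-1\}$, the von Neumann algebra $\mathcal{B}^{(n)}$ is generated by the $n-1$ subalgebras $\mathcal{B}^{(n)}_{jk}$ with $k\in\{0,\ldots,n-1\}$, $k\neq j$; (2) every $j_\pi$ is injective, and $j_\pi j_\sigma=j_{\pi\circ\sigma}$ for all $\pi\in G_{np}$, $\sigma\in G_{pm}$, $n\ge p\ge m\ge 1$; (3) for every $n$, if the indices $i,k,j,l\in\{0,\ldots,n-1\}$ are all different, then the subalgebras $\mathcal{B}^{(n)}_{ik}$ and $\mathcal{B}^{(n)}_{jl}$ commute. Let $n$ be given, and let $i,j,k\in\{0,\ldots,n-1\}$ be all different and such that the subalgebras $\mathcal{B}^{(n)}_{jk}$ and $\mathcal{B}^{(n)}_{ji}$ commute. Then all the algebras $\mathcal{B}^{(m)}$ with $1\le m\le n$ are commutative.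
   Context: Homomorphisms of von Neumann algebras are understood as $*$-homomorphisms. The von Neumann algebra generated by a self-adjoint set $\mathcal{S}$ of operators is its double commutant $\mathcal{S}''$. Two subalgebras are said to commute if every element of the first commutes with every element of the second. Interpretation: $\mathcal{B}^{(n)}$ is the algebra of observables of a system of $n$ quantum reference frames $F_0,\ldots,F_{n-1}$ of the same kind, and $\mathcal{B}^{(n)}_{ik}$ is the subalgebra describing the relation between the frames $F_i$ and $F_k$. *)

(* Defs.v *)
From HB Require Import structures.
From mathcomp Require Import all_boot all_order all_algebra.
From mathcomp Require Import sesquilinear.
From mathcomp Require Import complex.
From mathcomp Require Import all_classical all_reals all_analysis.
Set Implicit Arguments.
Unset Strict Implicit.
Unset Printing Implicit Defensive.
Import Order.TTheory GRing.Theory Num.Theory numFieldNormedType.Exports.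

Local Open Scope classical_set_scope.
Local Open Scope complex_scope.
Local Open Scope ring_scope.

(* A complex Hilbert space: a Banach space over R[i] whose norm comes from an
   inner product, linear in its first argument and conjugate-linear in its
   second one. *)
Record hilbertType (R : realType) := Hilbert {
  hilbert_sort :> completeNormedModType R[i];
  inner : {dot hilbert_sort for Num.conj};
  inner_norm : forall x : hilbert_sort, inner x x = `|x| ^+ 2
}.

Arguments inner {R} h : rename.

Section Operators.
Context {R : realType}.
Implicit Types H : hilbertType R.

(* Operators are plain functions, so that sums and scalar multiples are the
   pointwise ones and the product is the composition. For linear maps between
   normed spaces, continuity is the same as boundedness. *)
Definition bounded_operator H (T : H -> H) : Prop := linear T /\ continuous T.

(* S = T^*; for bounded T, such an S exists by Riesz and is unique. *)
Definition adjoint_of H (T S : H -> H) : Prop :=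
  forall x y : H, inner H (T x) y = inner H x (S y).

Definition self_adjoint_set H (A : set (H -> H)) : Prop :=
  forall T, A T -> exists2 S, A S & adjoint_of T S.

Definition commuting_sets H (A B : set (H -> H)) : Prop :=
  forall S T, A S -> B T -> S \o T = T \o S.

Definition commutative_set H (A : set (H -> H)) : Prop := commuting_sets A A.

Definition commutant H (A : set (H -> H)) : set (H -> H) :=
  [set T | bounded_operator T /\ forall S, A S -> T \o S = S \o T].

Definition generated_vna H (A : set (H -> H)) : set (H -> H) :=
  commutant (commutant A).

(* The equality also says that all the elements of A are bounded, and that A is
   a subalgebra containing the identity. *)
Definition von_neumann_algebra H (A : set (H -> H)) : Prop :=
  self_adjoint_set A /\ generated_vna A = A.

(* The values of f outside of A are irrelevant, and f is
   required neither to preserve the identity nor to be normal. *)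
Record star_hom H H' (A : set (H -> H)) (A' : set (H' -> H'))
    (f : (H -> H) -> (H' -> H')) : Prop := StarHom {
  star_hom_sub : forall T, A T -> A' (f T);
  star_hom_linear : forall (a : R[i]) S T, A S -> A T ->
    f (a *: S + T) = a *: f S + f T;
  star_hom_mul : forall S T, A S -> A T -> f (S \o T) = f S \o f T;
  star_hom_adjoint : forall T S, A T -> A S ->
    adjoint_of T S -> adjoint_of (f T) (f S)
}.

End Operators.

Definition pair_map (n : nat) (i k : 'I_n) : 'I_2 -> 'I_n :=
  fun a => if a == ord0 then i else k.

(* B^(n)_{ik}, which describes the relation between the frames F_i and F_k. *)
Definition relation_alg (R : realType) (H : nat -> hilbertType R)
    (B : forall n, set (H n -> H n))
    (jmap : forall m n, ('I_m -> 'I_n) -> (H m -> H m) -> (H n -> H n))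
    (n : nat) (i k : 'I_n) : set (H n -> H n) :=
  jmap 2 n (pair_map i k) @` B 2.

(* Main.v *)
(* Flipping a pair of indices permutes B^(2), so B_ab = B_ba.  Transporting the
   hypothesis to B^(3) along an injective homomorphism, and then anywhere along
   homomorphisms, any two relation algebras sharing one index commute.  In
   B^(3) the algebra B_12 thus commutes with the generators B_01 and B_02, so it
   is central; being a copy of B^(2), it makes B^(2) commutative.  Every B^(m)
   with m >= 2 is then generated by commuting operators, and B^(1) embeds in
   B^(2). *)
Require Import Defs.
From HB Require Import structures.
From mathcomp Require Import all_boot all_order all_algebra.
From mathcomp Require Import sesquilinear.
From mathcomp Require Import complex.
From mathcomp Require Import all_classical all_reals all_analysis.
Set Implicit Arguments.
Unset Strict Implicit.
Unset Printing Implicit Defensive.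
Import Order.TTheory GRing.Theory Num.Theory numFieldNormedType.Exports.

Local Open Scope classical_set_scope.
Local Open Scope nat_scope.

Section Commutants.
Context {R : realType}.
Implicit Types H : hilbertType R.

Lemma commutant_comp H (A : set (H -> H)) S T :
  commutant A S -> commutant A T -> commutant A (S \o T).
Proof.
move=> [[linS contS] SA] [[linT contT] TA]; split; last first.
  by move=> U AU; rewrite -compA TA // compA SA.
split=> [a x y|x]; first by rewrite /= linT linS.
by apply: continuous_comp; [exact: contT | exact: contS].
Qed.

Lemma von_neumann_algebra_comp H (A : set (H -> H)) S T :
  von_neumann_algebra A -> A S -> A T -> A (S \o T).
Proof. by case=> _ <-; exact: commutant_comp. Qed.

Lemma generated_vna_commutant H (A C : set (H -> H)) :
  C `<=` commutant A -> commuting_sets (generated_vna A) C.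
Proof. by move=> CA S T [_ SA] /CA; exact: SA. Qed.

(** Commutants are used twice: as A lies in A', the algebra A'' commutes with A, so A'' lies in A';
    hence A'' commutes with A'' itself. Boundedness enters because a commutant contains bounded
    operators only. *)
Lemma commutative_generated_vna H (A : set (H -> H)) :
  (forall T, A T -> bounded_operator T) -> commutative_set A ->
  commutative_set (generated_vna A).
Proof.
move=> bA cA; apply: generated_vna_commutant => T AT; split=> [|S AS].
  by case: AT.
apply: (generated_vna_commutant _ AT AS) => U AU.
by split=> [|V AV]; [exact: bA | exact: cA].
Qed.

Lemma star_hom_commuting H H' (A : set (H -> H)) (A' : set (H' -> H')) f C D :
  star_hom A A' f -> C `<=` A -> D `<=` A ->
  commuting_sets C D -> commuting_sets (f @` C) (f @` D).
Proof.
move=> fhom CA DA CD _ _ [S CS <-] [T DT <-].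
have [AS AT] := (CA _ CS, DA _ DT).
by rewrite -(star_hom_mul fhom AS AT) -(star_hom_mul fhom AT AS) (CD S T).
Qed.

(** Both [S \o T] and [T \o S] lie in the algebra [A], where [f] is injective, and their images
    agree. *)
Lemma star_hom_commuting_inj H H' (A : set (H -> H)) (A' : set (H' -> H'))
    f C D :
  von_neumann_algebra A -> star_hom A A' f -> set_inj A f ->
  C `<=` A -> D `<=` A ->
  commuting_sets (f @` C) (f @` D) -> commuting_sets C D.
Proof.
move=> vA fhom finj CA DA CD S T CS DT.
have [AS AT] := (CA _ CS, DA _ DT).
apply: finj; rewrite ?inE; try exact: von_neumann_algebra_comp.
rewrite (star_hom_mul fhom AS AT) (star_hom_mul fhom AT AS).
by apply: CD; [exists S | exists T].
Qed.

End Commutants.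

Lemma pair_map_inj n (a b : 'I_n) : a != b -> injective (pair_map a b).
Proof.
move=> ab; have ba : b != a by rewrite eq_sym.
move=> [[|[|//]] x] [[|[|//]] y]; rewrite /pair_map -!val_eqE /= => E;
  first [exact: val_inj | by rewrite E eqxx in ab | by rewrite E eqxx in ba].
Qed.

Lemma comp_pair_map m n (f : 'I_m -> 'I_n) a b :
  f \o pair_map a b = pair_map (f a) (f b).
Proof. by apply/funext => x /=; rewrite /pair_map; case: ifP. Qed.

(** Reading the map off a tuple turns its injectivity into [uniq]. *)
Definition triple_map n (a b c : 'I_n) : 'I_3 -> 'I_n := tnth [tuple a; b; c].

Lemma triple_map_inj n (a b c : 'I_n) :
  uniq [:: a; b; c] -> injective (triple_map a b c).
Proof. by move=> abc; apply/tuple_uniqP. Qed.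

Theorem proposition2 (R : realType) (H : nat -> hilbertType R)
    (B : forall n, set (H n -> H n))
    (jmap : forall m n, ('I_m -> 'I_n) -> (H m -> H m) -> (H n -> H n))
    (B_vna : forall n, 1 <= n -> von_neumann_algebra (B n))
    (jmap_hom : forall m n (pi : 'I_m -> 'I_n), 1 <= m <= n -> injective pi ->
       star_hom (B m) (B n) (jmap m n pi))
    (B_gen : forall n (j : 'I_n), 2 <= n ->
       B n = generated_vna
         (\bigcup_(k in [set k : 'I_n | k != j]) relation_alg B jmap j k))
    (jmap_inj : forall m n (pi : 'I_m -> 'I_n), 1 <= m <= n -> injective pi ->
       set_inj (B m) (jmap m n pi))
    (jmap_comp : forall m p n (pi : 'I_p -> 'I_n) (sigma : 'I_m -> 'I_p),
       1 <= m <= p -> p <= n -> injective pi -> injective sigma ->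
       forall T, B m T -> jmap p n pi (jmap m p sigma T) = jmap m n (pi \o sigma) T)
    (B_comm : forall n (i k j l : 'I_n), uniq [:: i; k; j; l] ->
       commuting_sets (relation_alg B jmap i k) (relation_alg B jmap j l))
    (n : nat) (i j k : 'I_n) (ijk_distinct : uniq [:: i; j; k])
    (jk_ji_comm :
       commuting_sets (relation_alg B jmap j k) (relation_alg B jmap j i)) :
  forall m, 1 <= m <= n -> commutative_set (B m).
Proof.
have rel_sub p (a b : 'I_p) : 2 <= p -> a != b ->
    relation_alg B jmap a b `<=` B p.
  move=> p2 ab _ [T BT <-].
  by apply: (star_hom_sub (jmap_hom _ _ _ _ (pair_map_inj ab))).
have relE p q (f : 'I_p -> 'I_q) a b : 2 <= p <= q -> injective f -> a != b ->
    relation_alg B jmap (f a) (f b) = jmap p q f @` relation_alg B jmap a b.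
  move=> /andP[p2 pq] finj ab; rewrite /relation_alg image_comp.
  apply: eq_imagel => T BT; rewrite /= -comp_pair_map jmap_comp //.
  exact: pair_map_inj.
have rel_subC p (a b : 'I_p) : 2 <= p -> a != b ->
    relation_alg B jmap a b `<=` relation_alg B jmap b a.
  move=> p2 ab _ [T BT <-].
  have flipI : injective (pair_map ord_max ord0 : 'I_2 -> 'I_2).
    exact: pair_map_inj.
  (* The flip is undone by swapping the indices: [pair_map b a] after the flip is [pair_map a b]. *)
  exists (jmap 2 2 (pair_map ord_max ord0) T).
    exact: (star_hom_sub (jmap_hom _ _ _ _ flipI)).
  rewrite jmap_comp //; last by apply: pair_map_inj; rewrite eq_sym.
  by rewrite comp_pair_map.
have relC p (a b : 'I_p) : 2 <= p -> a != b ->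
    relation_alg B jmap a b = relation_alg B jmap b a.
  by move=> p2 ab; apply/seteqP; split; apply: rel_subC; rewrite // eq_sym.
have n3 : 3 <= n.
  by have := leq_card _ (triple_map_inj ijk_distinct); rewrite !card_ord.
pose o0 : 'I_3 := @Ordinal 3 0 isT.
pose o1 : 'I_3 := @Ordinal 3 1 isT.
pose o2 : 'I_3 := @Ordinal 3 2 isT.
have comm3 : commuting_sets (relation_alg B jmap o0 o1)
                            (relation_alg B jmap o0 o2).
  (* The shared index [j] becomes 0, while [k] and [i] become 1 and 2. *)
  have jkiI : injective (triple_map j k i).
    by apply: triple_map_inj; rewrite -(rot_uniq 2).
  apply: (star_hom_commuting_inj (B_vna 3 isT) (jmap_hom _ _ _ _ jkiI)) => //.
  - exact: jmap_inj.
  - exact: rel_sub.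
  - exact: rel_sub.
  - by rewrite -!relE.
have comm p (a b c : 'I_p) : uniq [:: a; b; c] ->
    commuting_sets (relation_alg B jmap a b) (relation_alg B jmap a c).
  move=> abc; have abcI := triple_map_inj abc.
  have p3 : 3 <= p by have := leq_card _ abcI; rewrite !card_ord.
  have := star_hom_commuting (jmap_hom 3 p _ p3 abcI) _ _ comm3.
  by rewrite -!relE //; apply; exact: rel_sub.
have central : relation_alg B jmap o1 o2 `<=`
    commutant (\bigcup_(l in [set l : 'I_3 | l != o0])
                 relation_alg B jmap o0 l).
  move=> T T12; split.
    (* Elements of [B 3] are bounded, since [B 3] is itself a commutant. *)
    by have := rel_sub 3 o1 o2 isT isT T T12; case: (B_vna 3 isT) => _ <- [].
  move=> S [l /= l0]; have [->|->] : l = o1 \/ l = o2.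
  - by case: l l0 => [[|[|[|//]]] l3] // _; [left|right]; exact: val_inj.
  (* Both generators are flipped so that the index shared with [T] comes first: 1 here, 2 in the
     next case. *)
  - by rewrite relC // => S10; apply: (comm 3 o1 o2 o0).
  - by rewrite relC // => S20; apply: (comm 3 o2 o1 o0) => //; rewrite relC.
have B2_comm : commutative_set (B 2).
  have oI : injective (pair_map o1 o2) by exact: pair_map_inj.
  apply: (star_hom_commuting_inj (B_vna 2 isT) (jmap_hom _ _ _ _ oI)) => //.
    exact: jmap_inj.
  (* [S] is used only as an element of [B 3], which is generated by the algebras at index 0; [T]
     commutes with all of it. *)
  move=> S T S12 T12; apply: (generated_vna_commutant central _ T12).
  by rewrite -B_gen //; apply: rel_sub S12.
move=> [//|[_|m _]].
  have oI : injective (fun _ : 'I_1 => ord0 : 'I_2).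
    by move=> x y; rewrite !ord1.
  apply: (star_hom_commuting_inj (B_vna 1 isT) (jmap_hom _ _ _ _ oI)) => //.
    exact: jmap_inj.
  move=> _ _ [S BS <-] [T BT <-].
  by apply: B2_comm; exact: (star_hom_sub (jmap_hom _ _ _ _ oI)).
rewrite (B_gen m.+2 ord0) //; apply: commutative_generated_vna.
  move=> T [l /= l0 Tl]; have := rel_sub m.+2 ord0 l isT.
  by rewrite eq_sym => /(_ l0 T Tl); case: (B_vna m.+2 isT) => _ <- [].
(* Generators from different algebras share the index 0; those from the same one lie in an image of
   the commutative [B 2]. *)
move=> S T [a /= a0 Sa] [b /= b0 Tb]; have [ab|ab] := eqVneq a b; last first.
  apply: (comm m.+2 ord0 a b) => //=.
  by rewrite !inE ab negb_or ![ord0 == _]eq_sym a0 b0.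
move: Tb; rewrite -ab => Ta.
have aI : injective (pair_map ord0 a) by apply: pair_map_inj; rewrite eq_sym.
by apply: (star_hom_commuting (jmap_hom 2 m.+2 _ _ aI) _ _ B2_comm Sa Ta).
Qed.
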